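(* Consider the hypergraph stochastic blockmodel with $Q$ groups, $n$ nodes and largest hyperedge size $M$, and an observed hypergraph $Y$. Given the current model parameters $\theta=(\pi_q,B^{(m)}_{q_1,\dots,q_m})_{q,\,m,\,q_1\le\dots\le q_m}$ at any iteration of the variational EM algorithm, the corresponding optimal values $(\widehat\tau_{iq})_{i,q}$ of the variational parameters, i.e. $$\widehat\tau=\arg\max_\tau\ \mathcal J(\theta,\tau)\quad\text{subject to } \sum_{q=1}^Q\widehat\tau_{iq}=1\ \text{ for all } i=1,\dots,n,$$ satisfy the fixed point equation $$\log\widehat\tau_{iq}=\log\pi_q+\sum_{m=1}^{M-1}\ \sum_{1\le q_1\le\dots\le q_m\le Q}\ \sum_{\substack{(i_1,\dots,i_m)\in\mathcal V^m\\ \text{s.t. } \{i,i_1,\dots,i_m\}\in\mathcal V^{(m+1)}}}\widehat\tau_{i_1q_1}\cdots\widehat\tau_{i_mq_m}\,f\big(Y_{i,i_1,\dots,i_m},B^{(m+1)}_{q,q_1,\dots,q_m}\big)+c_i,$$ for any $1\le i\le n$ and $1\le q\le Q$, where the $c_i$ are normalising constants such that $\sum_q\widehat\tau_{iq}=1$.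
   Context: Nodes are $\mathcal V=\{1,\dots,n\}$. $\mathcal V^{(m)}$ is the set of (unordered) subsets $\{i_1,\dots,i_m\}$ of $m$ distinct nodes, and $\mathcal V^m$ is the set of (ordered) tuples $(i_1,\dots,i_m)$ of $m$ distinct nodes. A simple hypergraph with hyperedge sizes between $2$ and $M$ is encoded by indicators $Y_{i_1,\dots,i_m}\in\{0,1\}$, one for each $\{i_1,\dots,i_m\}\in\mathcal V^{(m)}$, $2\le m\le M$ (the value does not depend on the order of the indices). Hypergraph stochastic blockmodel: $Z_1,\dots,Z_n$ are i.i.d. latent variables in $\{1,\dots,Q\}$ with $\mathbb P_\theta(Z_i=q)=\pi_q$, $\pi_q\ge 0$, $\sum_q\pi_q=1$; given $Z=(Z_1,\dots,Z_n)$ the indicators are independent, $Y_{i_1,\dots,i_m}$ being Bernoulli with parameter $B^{(m)}_{Z_{i_1},\dots,Z_{i_m}}\in[0,1]$, where each tensor $B^{(m)}$ is fully symmetric in its $m$ indices. $f(y,b)=y\log b+(1-y)\log(1-b)$ for $y\in\{0,1\}$. The variational parameters $\tau=(\tau_{iq})$ satisfy $\tau_{iq}\in[0,1]$ and $\sum_{q=1}^Q\tau_{iq}=1$ for every $i$; $\mathbb Q_\tau$ is the distribution on $\{1,\dots,Q\}^n$ under which $Z_1,\dots,Z_n$ are independent with $\mathbb Q_\tau(Z_i=q)=\tau_{iq}$. The evidence lower bound is defined, and written out, as $$\mathcal J(\theta,\tau)=\mathbb E_{\mathbb Q_\tau}[\log\mathbb P_\theta(Y,Z)]-\mathbb E_{\mathbb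 Q_\tau}[\log\mathbb Q_\tau(Z)]$$ $$=\sum_{q=1}^Q\sum_{i=1}^n\tau_{iq}\log\frac{\pi_q}{\tau_{iq}}+\sum_{m=2}^M\ \sum_{q_1\le\dots\le q_m}\ \sum_{(i_1,\dots,i_m)\in\mathcal V^m}\tau_{i_1q_1}\cdots\tau_{i_mq_m}\,f\big(Y_{i_1,\dots,i_m},B^{(m)}_{q_1,\dots,q_m}\big).$$ The variational EM algorithm alternates maximization of $\mathcal J$ in $\tau$ (for the current $\theta$) and in $\theta$ (for the current $\tau$).
   Formalization: The inner sum counts each labelled node set {(i_1,q_1),...,(i_m,q_m)} once, since summing all ordered tuples overcounts tied labels and is false for M≥3; P_θ(Y)>0 is assumed, else J is identically −∞; J is its expectation definition. *)

(* Defs.v *)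
(* MathComp / MathComp-Analysis *)
From HB Require Import structures.
From mathcomp Require Import all_boot all_order all_algebra.
From mathcomp Require Import all_classical all_reals all_analysis.
Set Implicit Arguments.
Unset Strict Implicit.
Unset Printing Implicit Defensive.
Import Order.TTheory GRing.Theory Num.Theory.
Local Open Scope ring_scope.

(* Logarithms are taken in [\bar R]: [lne 0 = -oo], and [0 * -oo = 0] there, so
   the conventions 0 log 0 = 0 and 0 log (x / 0) = 0 hold.  This keeps the
   boundary values 0 and 1 of all parameters.  All logarithms below are
   nonpositive, so [+oo - +oo] never occurs. *)

Definition simple_hypergraph (n M : nat) (Y : {set {set 'I_n}}) : Prop :=
  forall e, e \in Y -> (2 <= #|e| <= M)%N.

(* Only the tensors [conn m] with 2 <= m <= M are constrained, and used. *)
Record hsbm_param (R : realType) (Q M : nat) := HsbmParam {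
  group_prob : 'I_Q -> R;
  conn : forall m : nat, m.-tuple 'I_Q -> R;
  group_prob_ge0 : forall q, 0 <= group_prob q;
  group_prob_sum1 : \sum_q group_prob q = 1;
  conn_bounds : forall m (q_ : m.-tuple 'I_Q),
    (2 <= m <= M)%N -> 0 <= conn q_ <= 1;
  conn_sym : forall m (q_ r_ : m.-tuple 'I_Q),
    (2 <= m <= M)%N -> perm_eq q_ r_ -> conn q_ = conn r_ }.

Section Hsbm.
Context {R : realType} {n Q M : nat}.
Implicit Types (theta : hsbm_param R Q M) (tau : 'M[R]_(n, Q)).
Implicit Types (Y : {set {set 'I_n}}) (z : {ffun 'I_n -> 'I_Q}).

(* P_theta(Y, Z = z).  By [conn_sym], the enumeration order of [e] is
   irrelevant. *)
Definition complete_likelihood theta Y z : R :=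
  (\prod_i group_prob theta (z i)) *
  \prod_(e : {set 'I_n} | (2 <= #|e| <= M)%N)
     bernoulli_pmf (conn theta (map_tuple z (enum_tuple e))) (e \in Y).

Definition likelihood theta Y : R := \sum_z complete_likelihood theta Y z.

Definition variational tau : Prop :=
  (forall i q, 0 <= tau i q <= 1) /\ (forall i, \sum_q tau i q = 1).

(* Q_tau(Z = z) *)
Definition var_pmf tau z : R := \prod_i tau i (z i).

Definition var_expectation tau (g : {ffun 'I_n -> 'I_Q} -> \bar R) : \bar R :=
  (\sum_z (var_pmf tau z)%:E * g z)%E.

Definition elbo theta Y tau : \bar R :=
  (var_expectation tau (fun z => lne (complete_likelihood theta Y z)%:E)
   - var_expectation tau (fun z => lne (var_pmf tau z)%:E))%E.

Definition is_argmax_elbo theta Y tau : Prop :=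
  variational tau /\
  forall tau', variational tau' -> (elbo theta Y tau' <= elbo theta Y tau)%E.

(* f(y, b) = y log b + (1 - y) log (1 - b) *)
Definition bern_log (y : bool) (b : R) : \bar R :=
  (y%:R%:E * lne b%:E + (1 - y%:R)%:E * lne (1 - b)%:E)%E.

(* Permuting nodes carrying equal labels does not change the labelled node set
   {(i_1, q_1), ..., (i_m, q_m)}.  Among the tuples of distinct nodes obtained
   in this way, this selects the one that increases along each group of equal
   labels; when [q_] is nondecreasing, every labelled node set is thus counted
   exactly once. *)
Definition group_increasing m (q_ : m.-tuple 'I_Q) (i_ : m.-tuple 'I_n) :=
  [forall k : 'I_m, forall l : 'I_m,
    ((k < l)%N && (tnth q_ k == tnth q_ l)) ==> (tnth i_ k < tnth i_ l)%N].

Definition fixed_point_term theta Y tau (i : 'I_n) (q : 'I_Q) : \bar R :=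
  (\sum_(1 <= m < M)
   \sum_(q_ : m.-tuple 'I_Q | sorted leq (map val q_))
   \sum_(i_ : m.-tuple 'I_n | uniq (i :: i_) && group_increasing q_ i_)
     (\prod_(k < m) tau (tnth i_ k) (tnth q_ k))%:E *
     bern_log ([set j in i :: i_] \in Y) (conn theta (cons_tuple q q_)))%E.

End Hsbm.

(* Main.v *)
Require Import Defs.
From HB Require Import structures.
From mathcomp Require Import all_boot all_order all_algebra perm.
From mathcomp Require Import all_classical all_reals all_analysis.
From mathcomp Require Import zify ring.
Set Implicit Arguments.
Unset Strict Implicit.
Unset Printing Implicit Defensive.
Import Order.TTheory GRing.Theory Num.Theory.
Local Open Scope ring_scope.

(* With all rows of tau but the i-th fixed, the lower bound is, up to a constant,
   the map p |-> sum_q p_q A_q - sum_q p_q log p_q on the simplex, where A_q is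
   the mean of log P_theta(Y, Z) with Z_i clamped to q.  Gibbs' inequality shows
   that its only maximizer is p_q = exp(A_q) / Z (with exp(-oo) = 0); the
   positivity of the likelihood of Y ensures that some A_q is finite.  In A_q only
   log pi_q and the hyperedges through i depend on q, and the rest is the finite
   part of c_i.  Grouping those hyperedges by the sorted sequence of the labels
   of their other nodes gives the sum of the fixed point equation. *)

(** * Extended logarithms and Gibbs' inequality *)

Lemma lne_bernoulli_pmf (R : realType) (b : R) (y : bool) :
  lne (bernoulli_pmf b y)%:E = bern_log y b.
Proof.
by case: y; rewrite /bern_log /= ?subrr ?subr0 ?mul0e ?mul1e ?adde0 ?add0e.
Qed.

(** If a factor vanishes, both sides are [-oo], which absorbs every summand. *)
Lemma lne_mulr (R : realType) (x y : R) (x_ge0 : 0 <= x) (y_ge0 : 0 <= y) :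
  lne (x * y)%:E = (lne x%:E + lne y%:E)%E.
Proof.
move: x_ge0; rewrite le_eqVlt => /predU1P[<-|x_gt0].
  by rewrite mul0r le0_lneNy// addNye.
move: y_ge0; rewrite le_eqVlt => /predU1P[<-|y_gt0].
  by rewrite mulr0 [lne 0]le0_lneNy// addeNy.
by rewrite EFinM lneM // in_itv /= lte_fin leey ?x_gt0 ?y_gt0.
Qed.

Lemma lne_prod (R : realType) (I : Type) (r : seq I) (P : pred I)
    (F : I -> R) (F_ge0 : forall i, P i -> 0 <= F i) :
  lne (\prod_(i <- r | P i) F i)%:E = (\sum_(i <- r | P i) lne (F i)%:E)%E.
Proof.
elim: r => [|i r IHr]; first by rewrite !big_nil lne1.
rewrite !big_cons; case: ifP => // Pi; rewrite -IHr lne_mulr ?F_ge0 //.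
exact: prodr_ge0.
Qed.

(** With [p'] proportional to [exp(A)], the objective at [p'] exceeds that at [p] by the
    Kullback-Leibler divergence of [p] from [p']. Maximality of [p] makes this gap nonpositive,
    hence zero. *)
Lemma gibbs_argmax (R : realType) (Q : nat) (p : 'I_Q -> R) (A : 'I_Q -> \bar R)
    (A_le0 : forall q, (A q <= 0)%E) (p_ge0 : forall q, 0 <= p q)
    (p_sum1 : \sum_q p q = 1)
    (pA_fin : (-oo < \sum_q (p q)%:E * A q)%E)
    (p_max : forall p' : 'I_Q -> R, (forall q, 0 <= p' q) -> \sum_q p' q = 1 ->
       (\sum_q (p' q)%:E * A q - (\sum_q p' q * ln (p' q))%:E <=
        \sum_q (p q)%:E * A q - (\sum_q p q * ln (p q))%:E)%E) :
  exists c : R, forall q, lne (p q)%:E = (A q + c%:E)%E.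
Proof.
have A_lty q : (A q < +oo)%E by apply: le_lt_trans (A_le0 q) _; rewrite ltry.
have pA_le0 q : ((p q)%:E * A q <= 0)%E by rewrite mule_ge0_le0 // lee_fin.
pose a q := fine (A q).
pose S q := A q \is a fin_num.
have SE q : S q -> A q = (a q)%:E by move=> Sq; rewrite /a fineK.
have NSE q : ~~ S q -> A q = -oo%E.
  by rewrite /S fin_numE (lt_eqF (A_lty q)) andbT negbK => /eqP.
(* Positive mass at a point where [A q = -oo] would make the whole mean [-oo]. *)
have p_supp q : ~~ S q -> p q = 0.
  move=> /NSE Aq; apply/eqP; rewrite eq_le p_ge0 andbT leNgt; apply/negP => pq_gt0.
  by move: pA_fin; rewrite (bigD1 q) //= Aq mulrNy gtr0_sg // mul1e addNye ltxx.
pose Z := \sum_(q | S q) expR (a q).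
have [q0 Sq0] : exists q, S q.
  case: (pickP S) => [q Sq|noS]; first by exists q.
  move/eqP: p_sum1.
  by rewrite big1 ?[_ == 1]eq_sym ?oner_eq0 // => q _; rewrite p_supp ?noS.
have Z_gt0 : 0 < Z.
  by rewrite /Z (bigD1 q0) //= ltr_wpDr ?expR_gt0 // sumr_ge0 // => q _; rewrite expR_ge0.
pose p' q := if S q then expR (a q) / Z else 0.
have p'_ge0 q : 0 <= p' q.
  by rewrite /p'; case: ifP => // _; rewrite divr_ge0 ?expR_ge0 // ltW.
have p'_sum1 : \sum_q p' q = 1.
  by rewrite -big_mkcond /= -mulr_suml divff // gt_eqF.
have ln_p' q : S q -> ln (p' q) = a q - ln Z.
  by move=> Sq; rewrite /p' Sq ln_div ?posrE ?expR_gt0 // expRK.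
have sumA (r : 'I_Q -> R) : (forall q, ~~ S q -> r q = 0) ->
    (\sum_q (r q)%:E * A q = (\sum_q r q * a q)%:E)%E.
  move=> r_supp; rewrite -sumEFin; apply: eq_bigr => q _.
  have [/SE ->|/r_supp ->] := boolP (S q); first by rewrite EFinM.
  by rewrite mul0r mul0e.
have := p_max p' p'_ge0 p'_sum1.
rewrite !sumA //; last by move=> q /negPf Sq; rewrite /p' Sq.
rewrite -!EFinB lee_fin -!sumrB.
(* On the support of [p'], [a q - ln (p' q)] is constantly [ln Z], and [p'] has mass 1. *)
have -> : \sum_q (p' q * a q - p' q * ln (p' q)) = ln Z.
  rewrite -[RHS]mul1r -p'_sum1 mulr_suml; apply: eq_bigr => q _.
  have [Sq|/negPf Sq] := boolP (S q); last by rewrite /p' Sq !mul0r subrr.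
  by rewrite ln_p' // mulrBr opprB addrC subrK.
move=> max_ge.
(* [h q] is the pointwise defect in [ln x <= x - 1] at [x = p' q / p q],
   weighted by [p q]; its sum is at most 0 by maximality of [p]. *)
pose h q := p' q - p q - p q * (a q - ln Z - ln (p q)).
have h_ge0 q : 0 <= h q ?= iff (p q == p' q).
  have [pq_gt0|pq_le0] := ltP 0 (p q); last first.
    (* At [p q = 0] the defect reduces to [p' q], so it still vanishes exactly when [p q = p' q]. *)
    have pq0 : p q = 0 by apply/eqP; rewrite eq_le p_ge0 pq_le0.
    by rewrite /h pq0 mul0r !subr0; split; rewrite ?p'_ge0.
  have Sq : S q by apply: contraTT pq_gt0 => /p_supp ->; rewrite ltxx.
  have p'q_gt0 : 0 < p' q by rewrite /p' Sq divr_gt0 ?expR_gt0.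
  have -> : h q = p q * (expR (ln (p' q / p q)) - 1 - ln (p' q / p q)).
    rewrite lnK ?posrE ?divr_gt0 // ln_div ?posrE // ln_p' // /h.
    by field; rewrite gt_eqF.
  have [<-|neq] := eqVneq (p q) (p' q).
    by rewrite divff ?gt_eqF // ln1 expR0 subrr subr0 mulr0; split; rewrite ?eqxx.
  have lnq_neq0 : ln (p' q / p q) != 0.
    rewrite ln_eq0 ?divr_gt0 //; apply: contra_neq neq => /divr1_eq.
    exact.
  have : 0 < p q * (expR (ln (p' q / p q)) - 1 - ln (p' q / p q)).
    by rewrite mulr_gt0 // -addrA -opprD subr_gt0 expR_gt1Dx.
  by move=> h_gt0; split; rewrite ?ltW // lt_eqF.
have sum_h : \sum_q h q <= 0.
  rewrite /h sumrB sumrB p'_sum1 p_sum1 subrr sub0r oppr_le0.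
  rewrite (eq_bigr (fun q => (p q * a q - p q * ln (p q)) - p q * ln Z)).
    by rewrite sumrB -mulr_suml p_sum1 mul1r subr_ge0.
  by move=> q _; ring.
have p_eq q : p q = p' q.
  (* Nonnegative defects with a nonpositive sum all vanish; the equality case of each gives
     [p q = p' q]. *)
  have sum_ge0 := leif_sum (fun q (_ : xpredT q) => h_ge0 q).
  rewrite big1_eq in sum_ge0.
  by move: sum_h; rewrite (ge_leif sum_ge0) => /forallP/(_ q)/eqP.
exists (- ln Z) => q; rewrite p_eq.
have [Sq|Sq] := boolP (S q).
  rewrite lne_EFin; last by rewrite /p' Sq divr_gt0 ?expR_gt0.
  by rewrite ln_p' // SE.
by rewrite /p' (negPf Sq) NSE // addNye le0_lneNy.
Qed.

(** * Expectations under the product law and their dependence on one row *)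

Definition set_row (R : realType) (n Q : nat) (tau : 'M[R]_(n, Q)) (i : 'I_n)
    (p : 'I_Q -> R) : 'M[R]_(n, Q) :=
  \matrix_(j, q) if j == i then p q else tau j q.

(* [Z_i] is almost surely [q] under this variational distribution. *)
Definition clamp_row (R : realType) (n Q : nat) (tau : 'M[R]_(n, Q)) (i : 'I_n)
    (q : 'I_Q) : 'M[R]_(n, Q) := set_row tau i (fun r => (r == q)%:R).

Lemma variational_set_row (R : realType) (n Q : nat) (tau : 'M[R]_(n, Q))
    (i : 'I_n) (p : 'I_Q -> R) (p_ge0 : forall q, 0 <= p q)
    (p_sum1 : \sum_q p q = 1) :
  variational tau -> variational (set_row tau i p).
Proof.
move=> [tau01 tau_sum1]; split=> [j q|j]; last first.
  have [->|neq_ji] := eqVneq j i.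
    by rewrite -[RHS]p_sum1; apply: eq_bigr => q _; rewrite mxE eqxx.
  by rewrite -[RHS](tau_sum1 j); apply: eq_bigr => q _; rewrite mxE (negPf neq_ji).
rewrite mxE; case: ifP => _ //; rewrite p_ge0 /= -p_sum1 (bigD1 q) //= lerDl.
exact: sumr_ge0.
Qed.

Lemma variational_clamp_row (R : realType) (n Q : nat) (tau : 'M[R]_(n, Q))
    (i : 'I_n) (q : 'I_Q) :
  variational tau -> variational (clamp_row tau i q).
Proof.
apply: variational_set_row => [r|]; first exact: ler0n.
by rewrite (bigD1 q) //= eqxx big1 ?addr0 // => r /negPf ->.
Qed.

Lemma var_pmf_ge0 (R : realType) (n Q : nat) (tau : 'M[R]_(n, Q))
    (tau_var : variational tau) z : 0 <= var_pmf tau z.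
Proof. by apply: prodr_ge0 => i _; case/andP: (tau_var.1 i (z i)). Qed.

(** Nonpositive summands rule out [+oo - oo], so multiplication by the weights distributes in
    [\bar R]. *)
Lemma var_expectation_sum (R : realType) (n Q : nat) (tau : 'M[R]_(n, Q))
    (I : Type) (r : seq I) (P : pred I) (g : I -> {ffun 'I_n -> 'I_Q} -> \bar R)
    (g_le0 : forall k z, P k -> (g k z <= 0)%E) :
  var_expectation tau (fun z => \sum_(k <- r | P k) g k z)%E =
  (\sum_(k <- r | P k) var_expectation tau (g k))%E.
Proof.
rewrite /var_expectation exchange_big /=; apply: eq_bigr => z _.
by rewrite le0_sume_distrr // => k; exact: g_le0.
Qed.

Lemma var_expectationD (R : realType) (n Q : nat) (tau : 'M[R]_(n, Q))
    (g h : {ffun 'I_n -> 'I_Q} -> \bar R) (g_le0 : forall z, (g z <= 0)%E)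
    (h_le0 : forall z, (h z <= 0)%E) :
  var_expectation tau (fun z => g z + h z)%E =
  (var_expectation tau g + var_expectation tau h)%E.
Proof.
by rewrite /var_expectation -big_split; apply: eq_bigr => z _; rewrite le0_muleDr.
Qed.

Lemma var_expectation_le0 (R : realType) (n Q : nat) (tau : 'M[R]_(n, Q))
    (g : {ffun 'I_n -> 'I_Q} -> \bar R) (tau_var : variational tau)
    (g_le0 : forall z, (g z <= 0)%E) : (var_expectation tau g <= 0)%E.
Proof.
by apply: sume_le0 => z _; rewrite mule_ge0_le0 // lee_fin var_pmf_ge0.
Qed.

(** The constraint on [z] splits node by node, so the sum over [z] becomes a product over nodes: an
    unlisted node contributes its total mass 1, a listed one the mass of its prescribed label. *)
Lemma var_pmf_marginal (R : realType) (n Q m : nat) (tau : 'M[R]_(n, Q))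
    (i_ : m.-tuple 'I_n) (q_ : m.-tuple 'I_Q)
    (tau_sum1 : forall i, \sum_q tau i q = 1) (i_uniq : uniq i_) :
  \sum_(z : {ffun 'I_n -> 'I_Q} | map_tuple z i_ == q_) var_pmf tau z =
  \prod_(k < m) tau (tnth i_ k) (tnth q_ k).
Proof.
(* Label [q] agrees with whatever [q_] prescribes at node [j]; this is vacuous when [j] is not in
   [i_]. *)
pose ok j q := [forall k, (tnth i_ k == j) ==> (tnth q_ k == q)].
have okE (z : {ffun 'I_n -> 'I_Q}) : (map_tuple z i_ == q_) = [forall j, ok j (z j)].
  apply/eqP/forallP => [zq j|zok].
    by apply/forallP => k; apply/implyP => /eqP <-; rewrite -zq tnth_map.
  apply/eq_from_tnth => k; rewrite tnth_map; apply/esym/eqP.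
  exact: (implyP (forallP (zok _) k)).
transitivity (\prod_j \sum_q (if ok j q then tau j q else 0)).
  rewrite bigA_distr_bigA big_mkcond; apply: eq_bigr => z _; rewrite okE.
  case: ifPn => [/forallP zok|/forallPn[j nok]].
    by apply: eq_bigr => j _; rewrite zok.
  by rewrite (bigD1 j) //= (negPf nok) mul0r.
rewrite (bigID (mem i_)) /= [X in _ * X]big1 ?mulr1 => [|j i_j]; last first.
  rewrite -[RHS](tau_sum1 j); apply: eq_bigr => q _; case: ifPn => // /forallPn[k].
  by rewrite negb_imply => /andP[/eqP ij]; rewrite -ij mem_tnth in i_j.
rewrite -big_uniq // big_tuple; apply: eq_bigr => k _.
rewrite (bigD1 (tnth q_ k)) //= big1 ?addr0.
  case: ifPn => // /forallPn[l]; rewrite negb_imply => /andP[/eqP eq_lk].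
  by have /tuple_uniqP i_inj := i_uniq; rewrite (i_inj _ _ eq_lk) eqxx.
move=> q /negPf neq_q; case: ifPn => // /forallP/(_ k).
by rewrite eqxx eq_sym neq_q.
Qed.

Lemma var_pmf_sum1 (R : realType) (n Q : nat) (tau : 'M[R]_(n, Q))
    (tau_sum1 : forall i, \sum_q tau i q = 1) : \sum_z var_pmf tau z = 1.
Proof.
by rewrite -(bigA_distr_bigA (fun i q => tau i q)) big1.
Qed.

Lemma var_expectation_cst (R : realType) (n Q : nat) (tau : 'M[R]_(n, Q))
    (tau_var : variational tau) (b : \bar R) : var_expectation tau (fun=> b) = b.
Proof.
rewrite /var_expectation -ge0_sume_distrl => [|z _].
  by rewrite sumEFin var_pmf_sum1 ?mul1e //; exact: tau_var.2.
by rewrite lee_fin var_pmf_ge0.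
Qed.

Lemma var_expectation_marginal (R : realType) (n Q m : nat)
    (tau : 'M[R]_(n, Q)) (i_ : m.-tuple 'I_n) (q_ : m.-tuple 'I_Q) (b : \bar R)
    (tau_var : variational tau) (i_uniq : uniq i_) :
  var_expectation tau (fun z => if map_tuple z i_ == q_ then b else 0)%E =
  ((\prod_(k < m) tau (tnth i_ k) (tnth q_ k))%:E * b)%E.
Proof.
rewrite -(var_pmf_marginal q_ tau_var.2 i_uniq) -sumEFin ge0_sume_distrl => [|z _].
  by rewrite [RHS]big_mkcond; apply: eq_bigr => z _; case: ifP; rewrite ?mule0.
by rewrite lee_fin var_pmf_ge0.
Qed.

Lemma var_pmf_marginal1 (R : realType) (n Q : nat) (tau : 'M[R]_(n, Q))
    (i : 'I_n) (q : 'I_Q) (tau_sum1 : forall i, \sum_q tau i q = 1) :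
  \sum_(z : {ffun 'I_n -> 'I_Q} | z i == q) var_pmf tau z = tau i q.
Proof.
have := @var_pmf_marginal R n Q 1 tau [tuple i] [tuple q] tau_sum1 isT.
rewrite big_ord1 => <-; apply: eq_bigl => z.
by apply/eqP/eqP => [<-|/(congr1 val)[]//]; exact: val_inj.
Qed.

(** The logarithm of the product splits over nodes, and each term is averaged under its one-node
    marginal. The value is real because a factor [tau i q = 0] cancels its logarithm. *)
Lemma var_expectation_entropy (R : realType) (n Q : nat) (tau : 'M[R]_(n, Q))
    (tau_var : variational tau) :
  var_expectation tau (fun z => lne (var_pmf tau z)%:E) =
  (\sum_i \sum_q tau i q * ln (tau i q))%:E.
Proof.
transitivity (\sum_z (\sum_i var_pmf tau z * ln (tau i (z i)))%:E)%E.
  apply: eq_bigr => z _; rewrite -mulr_sumr.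
  (* Labellings of mass zero contribute 0; positive mass forces every factor to be positive, where
     [lne] agrees with [ln]. *)
  have := var_pmf_ge0 tau_var z; rewrite le_eqVlt => /predU1P[<-|z_gt0].
    by rewrite mul0e mul0r.
  have tau_gt0 i : 0 < tau i (z i).
    rewrite lt_neqAle (andP (tau_var.1 i (z i))).1 andbT.
    by apply: contraTneq z_gt0 => tau0; rewrite /var_pmf (bigD1 i) //= -tau0 mul0r ltxx.
  rewrite EFinM -sumEFin /var_pmf lne_prod //; last by move=> i _; exact: ltW.
  by congr (_ * _)%E; apply: eq_bigr => i _; rewrite lne_EFin.
rewrite sumEFin exchange_big /=. congr EFin; apply: eq_bigr => i _.
rewrite (partition_big (fun z : {ffun 'I_n -> 'I_Q} => z i) xpredT) //=.
apply: eq_bigr => q _.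
rewrite -[X in X * ln _](var_pmf_marginal1 i q tau_var.2) mulr_suml.
by apply: eq_bigr => z /eqP ->.
Qed.

Lemma var_pmf_set_row (R : realType) (n Q : nat) (tau : 'M[R]_(n, Q))
    (i : 'I_n) (p : 'I_Q -> R) z :
  var_pmf (set_row tau i p) z = p (z i) * \prod_(j | j != i) tau j (z j).
Proof.
rewrite /var_pmf (bigD1 i) //= mxE eqxx; congr (_ * _).
by apply: eq_bigr => j /negPf neq_ji; rewrite mxE neq_ji.
Qed.

(** Conditioning on the label of [i]: the new weights are the combination of the clamped laws with
    coefficients [p], so the expectation is linear in row [i]. *)
Lemma var_expectation_set_row (R : realType) (n Q : nat) (tau : 'M[R]_(n, Q))
    (i : 'I_n) (p : 'I_Q -> R) (g : {ffun 'I_n -> 'I_Q} -> \bar R)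
    (tau_var : variational tau) (p_ge0 : forall q, 0 <= p q)
    (g_le0 : forall z, (g z <= 0)%E) :
  var_expectation (set_row tau i p) g =
  (\sum_q (p q)%:E * var_expectation (clamp_row tau i q) g)%E.
Proof.
transitivity (\sum_q \sum_z ((p q)%:E * ((var_pmf (clamp_row tau i q) z)%:E * g z)))%E.
  rewrite exchange_big /=; apply: eq_bigr => z _.
  (* Only the law clamped at [z i] can charge [z]. *)
  rewrite (bigD1 (z i)) //= big1 ?adde0; last first.
    by move=> q neq_q; rewrite var_pmf_set_row eq_sym (negPf neq_q) mul0r mul0e mule0.
  by rewrite !var_pmf_set_row eqxx mul1r muleA -EFinM.
apply: eq_bigr => q _; rewrite le0_sume_distrr // => z _.
by rewrite mule_ge0_le0 // lee_fin var_pmf_ge0 //; exact: variational_clamp_row.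
Qed.

(** Exchanging [q] and [r] at node [i] is an involution of the labellings that carries one clamped
    law to the other and preserves [g]. *)
Lemma var_expectation_clamp_row (R : realType) (n Q : nat) (tau : 'M[R]_(n, Q))
    (i : 'I_n) (q r : 'I_Q) (g : {ffun 'I_n -> 'I_Q} -> \bar R)
    (g_indep : forall z z' : {ffun 'I_n -> 'I_Q},
       (forall j, j != i -> z j = z' j) -> g z = g z') :
  var_expectation (clamp_row tau i q) g = var_expectation (clamp_row tau i r) g.
Proof.
pose h (z : {ffun 'I_n -> 'I_Q}) :=
  [ffun j => if j == i then tperm q r (z j) else z j].
have hK : involutive h.
  by move=> z; apply/ffunP => j; rewrite !ffunE; case: eqP => // _; rewrite tpermK.
rewrite /var_expectation [RHS](reindex_inj (inv_inj hK)) /=.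
apply: eq_bigr => z _; congr (_%:E * _)%E; last first.
  by apply: g_indep => j /negPf neq_ji; rewrite ffunE neq_ji.
rewrite !var_pmf_set_row ffunE eqxx; congr (_%:R * _).
  by rewrite -{2}(tpermL q r) (inj_eq perm_inj).
by apply: eq_bigr => j /negPf neq_ji; rewrite ffunE neq_ji.
Qed.

Lemma eq_var_expectation_clamp_row (R : realType) (n Q : nat)
    (tau : 'M[R]_(n, Q)) (i : 'I_n) (q : 'I_Q)
    (g h : {ffun 'I_n -> 'I_Q} -> \bar R)
    (gh : forall z : {ffun _}, z i = q -> g z = h z) :
  var_expectation (clamp_row tau i q) g = var_expectation (clamp_row tau i q) h.
Proof.
apply: eq_bigr => z _; rewrite var_pmf_set_row.
by have [/gh ->|] := eqVneq (z i) q; rewrite ?mul0r ?mul0e.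
Qed.

(** * Enumerating the hyperedges through a node by sorted tuples *)

(* Given the labelling [z], a node set is listed by exactly one tuple [i_] such
   that the labels are sorted and [group_increasing] holds: its enumeration
   sorted by the lexicographic order of the pairs (label, node). *)
Definition label_node_le (n Q : nat) (z : 'I_n -> 'I_Q) : rel 'I_n :=
  fun j k => (z j < z k)%N || (val (z j) == val (z k)) && (j <= k)%N.

Lemma label_node_le_trans (n Q : nat) (z : 'I_n -> 'I_Q) :
  transitive (label_node_le z).
Proof. by move=> k j l; rewrite /label_node_le /=; lia. Qed.

Lemma label_node_le_total (n Q : nat) (z : 'I_n -> 'I_Q) :
  total (label_node_le z).
Proof. by move=> j k; rewrite /label_node_le /=; lia. Qed.

Lemma label_node_le_anti (n Q : nat) (z : 'I_n -> 'I_Q) :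
  antisymmetric (label_node_le z).
Proof. by move=> j k jk; apply: val_inj; move: jk; rewrite /label_node_le /=; lia. Qed.

Lemma pairwise_tnthP (T : Type) (m : nat) (r : rel T) (t : m.-tuple T) :
  reflect (forall k l : 'I_m, (k < l)%N -> r (tnth t k) (tnth t l)) (pairwise r t).
Proof.
case: m t => [|m] t; first by rewrite tuple0; apply: ReflectT => -[].
pose x0 := tnth t ord0.
apply: (iffP (pairwiseP x0)) => [r_t k l kl|r_t k l].
  by rewrite !(tnth_nth x0); apply: r_t; rewrite // inE size_tuple.
rewrite !inE size_tuple => lt_k lt_l kl.
by have := r_t (Ordinal lt_k) (Ordinal lt_l) kl; rewrite !(tnth_nth x0).
Qed.

(** The lexicographic order separates into its label part and its tie-breaking on equal labels.
    Distinctness of the nodes turns the weak tie-breaking into the strict one of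
    [group_increasing]. *)
Lemma sorted_label_node (n Q m : nat) (z : 'I_n -> 'I_Q) (i_ : m.-tuple 'I_n)
    (i_uniq : uniq i_) :
  sorted (label_node_le z) i_ =
  sorted leq (map val (map_tuple z i_)) && group_increasing (map_tuple z i_) i_.
Proof.
rewrite (sorted_pairwise (@label_node_le_trans _ _ z)) (sorted_pairwise leq_trans).
have i_inj : injective (tnth i_) by apply/tuple_uniqP.
apply/pairwise_tnthP/andP => [z_le|[z_le /forallP i_incr] k l kl].
  split.
    apply/(pairwise_tnthP _ (map_tuple val (map_tuple z i_))) => k l /z_le.
    by rewrite !tnth_map /label_node_le /=; lia.
  apply/forallP => k; apply/forallP => l; apply/implyP => /andP[kl].
  rewrite !tnth_map => /eqP/(congr1 val) /= z_eq.
  have neq_i : tnth i_ k <> tnth i_ l :> nat.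
    by move/val_inj/i_inj => eq_kl; rewrite eq_kl ltnn in kl.
  by move: (z_le _ _ kl) neq_i z_eq; rewrite /label_node_le /=; lia.
have := pairwise_tnthP _ (map_tuple val (map_tuple z i_)) z_le k l kl.
have := implyP (forallP (i_incr k) l).
by rewrite kl !tnth_map /label_node_le -val_eqE /=; lia.
Qed.

(** Under [z], the tuple [i_] determines [q_] as its label sequence, so the double sum is a
    partition of the single one. *)
Lemma big_group_increasing (R : realType) (n Q m : nat)
    (z : {ffun 'I_n -> 'I_Q}) (P : pred (m.-tuple 'I_n)) (F : m.-tuple 'I_n -> \bar R)
    (P_uniq : forall i_, P i_ -> uniq i_) :
  (\sum_(q_ : m.-tuple 'I_Q | sorted leq (map val q_))
   \sum_(i_ | P i_ && group_increasing q_ i_ && (map_tuple z i_ == q_)) F i_)%E =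
  (\sum_(i_ | P i_ && sorted (label_node_le z) i_) F i_)%E.
Proof.
rewrite [RHS](partition_big (fun i_ : m.-tuple _ => map_tuple z i_)
  (fun q_ : m.-tuple 'I_Q => sorted leq (map val q_))) /=; last first.
  by move=> i_ /andP[/P_uniq i_uniq]; rewrite sorted_label_node // => /andP[].
apply: eq_bigr => q_ q_sorted; apply: eq_bigl => i_; rewrite -!andbA.
case: (boolP (P i_)) => //= /P_uniq i_uniq; rewrite sorted_label_node //.
by case: eqP => [->|_]; rewrite ?andbF // q_sorted.
Qed.

(** Prepending [i] and forgetting the order is inverse to removing [i] and sorting; antisymmetry
    makes the sorted listing unique. *)
Lemma big_sorted_tuple (R : realType) (n m : nat) (r : rel 'I_n) (i : 'I_n)
    (G : {set 'I_n} -> \bar R) (r_trans : transitive r) (r_total : total r)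
    (r_anti : antisymmetric r) :
  (\sum_(i_ : m.-tuple 'I_n | uniq (i :: i_) && sorted r i_) G [set j in i :: i_])%E =
  (\sum_(e : {set 'I_n} | (#|e| == m.+1) && (i \in e)) G e)%E.
Proof.
(* The default tuple is only taken when [e :\ i] does not have [m] elements. *)
pose tuple_of (e : {set 'I_n}) : m.-tuple 'I_n :=
  insubd [tuple of nseq m i] (sort r (enum (e :\ i))).
have tuple_ofE (e : {set 'I_n}) : #|e :\ i| = m ->
    tuple_of e = sort r (enum (e :\ i)) :> seq _.
  by move=> card_e; rewrite val_insubd size_sort -cardE card_e eqxx.
rewrite [RHS](reindex_onto (fun i_ : m.-tuple 'I_n => [set j in i :: i_]) tuple_of).
  apply: eq_bigl => i_; rewrite inE mem_head andbT.
  apply/andP/andP => [[i_uniq i_sorted]|[card_i /eqP tupleK]].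
    have card_i : #|[set j in i :: i_]| = m.+1.
      by rewrite cardsE (card_uniqP i_uniq) /= size_tuple.
    split; first exact/eqP.
    have set_i : [set j in i :: i_] :\ i =i i_.
      move=> j; rewrite !inE; case: eqP => //= ->; apply/esym/negbTE.
      by case/andP: i_uniq.
    apply/eqP/val_inj; rewrite /= tuple_ofE.
      apply: (sorted_eq r_trans r_anti) => //; first exact: sort_sorted.
      rewrite perm_sort uniq_perm ?enum_uniq //; first by case/andP: i_uniq.
      by move=> j; rewrite mem_enum set_i.
    by rewrite (eq_card set_i) (card_uniqP _) ?size_tuple //; case/andP: i_uniq.
  (* A list of length [m.+1] whose underlying set has [m.+1] elements has no repetition. *)
  have i_uniq : uniq (i :: i_).
    by apply/card_uniqP; rewrite -cardsE (eqP card_i) /= size_tuple.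
  split=> //; rewrite -tupleK tuple_ofE; first exact: sort_sorted.
  by move/eqP: card_i; rewrite (cardsD1 i) inE mem_head add1n => -[].
move=> e /andP[/eqP card_e i_e]; apply/setP => j; rewrite !inE tuple_ofE.
  by rewrite mem_sort mem_enum !inE; case: eqP => // ->.
by move: card_e; rewrite (cardsD1 i) i_e add1n => -[].
Qed.

(** Here [m] is the hyperedge size minus one, which shifts the sizes from 2 to [M] to
    [1 <= m < M]. *)
Lemma big_card_range (R : realType) (n M : nat) (P : pred {set 'I_n})
    (G : {set 'I_n} -> \bar R) :
  (\sum_(e : {set 'I_n} | (2 <= #|e| <= M)%N && P e) G e)%E =
  (\sum_(1 <= m < M) \sum_(e : {set 'I_n} | (#|e| == m.+1) && P e) G e)%E.
Proof.
rewrite [RHS]big_nat_cond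
  (exchange_big_dep (fun e : {set 'I_n} => (2 <= #|e| <= M)%N && P e)) /=.
  apply: eq_bigr => e /andP[card_e Pe].
  have card_pred m : (1 <= m < M)%N && (#|e| == m.+1) = (m == #|e|.-1).
    by move: #|e| card_e => k; lia.
  under eq_bigl => m do rewrite andbT Pe andbT card_pred.
  by rewrite big_nat1_eq; case: ifP => //; move: #|e| card_e => k; lia.
by move=> m e; rewrite andbT => m_range /andP[/eqP -> ->]; rewrite andbT; lia.
Qed.

(** * Splitting the complete log-likelihood around one node *)

Definition edge_log (R : realType) (n Q M : nat) (theta : hsbm_param R Q M)
    (Y : {set {set 'I_n}}) (z : {ffun 'I_n -> 'I_Q}) (e : {set 'I_n}) : \bar R :=
  bern_log (e \in Y) (conn theta (map_tuple z (enum_tuple e))).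

Lemma bern_log_le0 (R : realType) (y : bool) (b : R) :
  0 <= b <= 1 -> (bern_log y b <= 0)%E.
Proof.
rewrite -lne_bernoulli_pmf lne_le0 lee_fin /bernoulli_pmf => /andP[b_ge0 b_le1].
by case: y => //; rewrite gerBl.
Qed.

Lemma edge_log_le0 (R : realType) (n Q M : nat) (theta : hsbm_param R Q M)
    (Y : {set {set 'I_n}}) z (e : {set 'I_n}) :
  (2 <= #|e| <= M)%N -> (edge_log theta Y z e <= 0)%E.
Proof. by move=> card_e; apply/bern_log_le0/conn_bounds. Qed.

Lemma lne_group_prob_le0 (R : realType) (Q M : nat) (theta : hsbm_param R Q M) q :
  (lne (group_prob theta q)%:E <= 0)%E.
Proof.
rewrite lne_le0 lee_fin -(group_prob_sum1 theta) (bigD1 q) //= lerDl.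
by apply: sumr_ge0 => r _; exact: group_prob_ge0.
Qed.

(** The two lengths are kept apart because a hyperedge is enumerated with length [#|e|] but listed
    with length [m.+1]; the permutation itself identifies them. *)
Lemma perm_conn (R : realType) (Q M m m' : nat) (theta : hsbm_param R Q M)
    (q_ : m.-tuple 'I_Q) (r_ : m'.-tuple 'I_Q) :
  (2 <= m <= M)%N -> perm_eq q_ r_ -> conn theta q_ = conn theta r_.
Proof.
move=> m_range qr; have eq_m : m = m' by move/perm_size: (qr); rewrite !size_tuple.
by case: m' / eq_m r_ qr => r_; exact: conn_sym.
Qed.

Lemma edge_log_cons (R : realType) (n Q M m : nat) (theta : hsbm_param R Q M)
    (Y : {set {set 'I_n}}) (z : {ffun 'I_n -> 'I_Q}) (i : 'I_n)
    (i_ : m.-tuple 'I_n) (m_range : (1 <= m < M)%N) (i_uniq : uniq (i :: i_)) :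
  edge_log theta Y z [set j in i :: i_] =
  bern_log ([set j in i :: i_] \in Y) (conn theta (cons_tuple (z i) (map_tuple z i_))).
Proof.
rewrite /edge_log; congr bern_log; symmetry; apply: perm_conn => //=.
apply: (perm_map z (s := i :: i_)).
by rewrite uniq_perm ?enum_uniq // => j; rewrite mem_enum [in RHS]inE.
Qed.

(* The part of log P_theta(Y, Z = z) that does not depend on the label of [i]. *)
Definition log_likelihood_away (R : realType) (n Q M : nat)
    (theta : hsbm_param R Q M) (Y : {set {set 'I_n}}) (i : 'I_n)
    (z : {ffun 'I_n -> 'I_Q}) : \bar R :=
  (\sum_(j | j != i) lne (group_prob theta (z j))%:E +
   \sum_(e : {set 'I_n} | (2 <= #|e| <= M)%N && (i \notin e)) edge_log theta Y z e)%E.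

Lemma lne_complete_likelihood (R : realType) (n Q M : nat)
    (theta : hsbm_param R Q M) (Y : {set {set 'I_n}}) (i : 'I_n) z :
  lne (complete_likelihood theta Y z)%:E =
  (lne (group_prob theta (z i))%:E +
   (\sum_(e : {set 'I_n} | (2 <= #|e| <= M)%N && (i \in e)) edge_log theta Y z e) +
   log_likelihood_away theta Y i z)%E.
Proof.
have bern_ge0 (e : {set 'I_n}) : (2 <= #|e| <= M)%N ->
    0 <= bernoulli_pmf (conn theta (map_tuple z (enum_tuple e))) (e \in Y).
  by move=> card_e; apply/bernoulli_pmf_ge0/conn_bounds.
have pi_ge0 j : xpredT j -> 0 <= group_prob theta (z j).
  by move=> _; exact: group_prob_ge0.
rewrite lne_mulr ?prodr_ge0 // !lne_prod //.
rewrite (bigD1 i) //= (bigID (fun e : {set 'I_n} => i \in e)) /= addeACA.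
by congr ((_ + _) + (_ + _))%E; apply: eq_bigr => e _; exact: lne_bernoulli_pmf.
Qed.

(** The test [map_tuple z i_ == q_] makes the index sets independent of [z], so that expectations
    can be taken term by term. Repeating the range of [m] as a filter makes it available when signs
    are checked. *)
Lemma edge_sum_eq (R : realType) (n Q M : nat) (theta : hsbm_param R Q M)
    (Y : {set {set 'I_n}}) (i : 'I_n) (z : {ffun 'I_n -> 'I_Q}) :
  (\sum_(e : {set 'I_n} | (2 <= #|e| <= M)%N && (i \in e)) edge_log theta Y z e)%E =
  (\sum_(1 <= m < M | (1 <= m < M)%N)
   \sum_(q_ : m.-tuple 'I_Q | sorted leq (map val q_))
   \sum_(i_ : m.-tuple 'I_n | uniq (i :: i_) && group_increasing q_ i_)
     if map_tuple z i_ == q_ then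
       bern_log ([set j in i :: i_] \in Y) (conn theta (cons_tuple (z i) q_))
     else 0)%E.
Proof.
rewrite big_card_range big_nat_cond; apply: eq_big => [m|m /andP[m_range _]].
  by rewrite andbT.
rewrite -(big_sorted_tuple m i _ (@label_node_le_trans _ _ z)
  (@label_node_le_total _ _ z) (@label_node_le_anti _ _ z)).
rewrite -big_group_increasing => [|i_ /andP[]//].
apply: eq_bigr => q_ _; rewrite big_mkcondr; apply: eq_bigr => i_ /andP[i_uniq _].
by case: eqP => // <-; rewrite edge_log_cons.
Qed.

Lemma var_expectation_edge_sum (R : realType) (n Q M : nat)
    (theta : hsbm_param R Q M) (Y : {set {set 'I_n}}) (tau : 'M[R]_(n, Q))
    (i : 'I_n) (q : 'I_Q) (tau_var : variational tau) :
  var_expectation (clamp_row tau i q) (fun z =>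
    \sum_(e : {set 'I_n} | (2 <= #|e| <= M)%N && (i \in e)) edge_log theta Y z e)%E =
  fixed_point_term theta Y tau i q.
Proof.
have clamp_var := variational_clamp_row i q tau_var.
pose term m (q_ : m.-tuple 'I_Q) (i_ : m.-tuple 'I_n) :=
  bern_log ([set j in i :: i_] \in Y) (conn theta (cons_tuple q q_)).
have term_le0 m q_ i_ : (1 <= m < M)%N -> (@term m q_ i_ <= 0)%E.
  by move=> m_range; apply/bern_log_le0/conn_bounds.
have ite_le0 m q_ i_ (b : bool) : (1 <= m < M)%N ->
    ((if b then @term m q_ i_ else 0) <= 0)%E.
  by case: b => // m_range; exact: term_le0.
under [LHS]eq_var_expectation_clamp_row => z zi.
  rewrite edge_sum_eq zi; over.
rewrite var_expectation_sum => [|m z m_range]; last first.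
  by apply: sume_le0 => q_ _; apply: sume_le0 => i_ _; exact: ite_le0.
rewrite /fixed_point_term [RHS]big_nat_cond; apply: eq_big => [m|m m_range].
  by rewrite andbT.
rewrite var_expectation_sum => [|q_ z _]; last first.
  by apply: sume_le0 => i_ _; exact: ite_le0.
apply: eq_bigr => q_ _; rewrite var_expectation_sum => [|i_ z _]; last exact: ite_le0.
apply: eq_bigr => i_ /andP[/= /andP[i_i_ i_uniq] _].
rewrite var_expectation_marginal //; congr (_%:E * _)%E; apply: eq_bigr => k _.
(* Since [i] does not occur in [i_], the clamped row is never read. *)
by rewrite mxE; case: eqP => // ik; rewrite -ik mem_tnth in i_i_.
Qed.

Lemma log_likelihood_away_le0 (R : realType) (n Q M : nat)
    (theta : hsbm_param R Q M) (Y : {set {set 'I_n}}) (i : 'I_n) z :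
  (log_likelihood_away theta Y i z <= 0)%E.
Proof.
apply: adde_le0; apply: sume_le0; first by move=> j _; exact: lne_group_prob_le0.
by move=> e /andP[card_e _]; exact: edge_log_le0.
Qed.

Lemma log_likelihood_away_indep (R : realType) (n Q M : nat)
    (theta : hsbm_param R Q M) (Y : {set {set 'I_n}}) (i : 'I_n)
    (z z' : {ffun 'I_n -> 'I_Q}) (zz' : forall j, j != i -> z j = z' j) :
  log_likelihood_away theta Y i z = log_likelihood_away theta Y i z'.
Proof.
congr (_ + _)%E; first by apply: eq_bigr => j /zz' ->.
apply: eq_bigr => e /andP[_ i_e]; congr (bern_log _ (conn _ _)); apply: val_inj => /=.
apply/eq_in_map => j; rewrite mem_enum => j_e; apply: zz'.
by apply: contraNneq i_e => <-.
Qed.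

(** The last term may be clamped at any [r], so a single choice serves all [q]: this is how it
    enters the normalising constant. *)
Lemma var_expectation_log_likelihood (R : realType) (n Q M : nat)
    (theta : hsbm_param R Q M) (Y : {set {set 'I_n}}) (tau : 'M[R]_(n, Q))
    (i : 'I_n) (q r : 'I_Q) (tau_var : variational tau) :
  var_expectation (clamp_row tau i q)
    (fun z => lne (complete_likelihood theta Y z)%:E) =
  (lne (group_prob theta q)%:E + fixed_point_term theta Y tau i q +
   var_expectation (clamp_row tau i r) (log_likelihood_away theta Y i))%E.
Proof.
have clamp_var := variational_clamp_row i q tau_var.
have edges_le0 z : (\sum_(e : {set 'I_n} | (2 <= #|e| <= M)%N && (i \in e))
    edge_log theta Y z e <= 0)%E.
  by apply: sume_le0 => e /andP[card_e _]; exact: edge_log_le0.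
under [LHS]eq_var_expectation_clamp_row => z zi.
  rewrite (lne_complete_likelihood theta Y i z) zi; over.
rewrite var_expectationD => [|z|z]; last 2 first.
- by rewrite adde_le0 ?lne_group_prob_le0.
- exact: log_likelihood_away_le0.
congr (_ + _)%E; last first.
  by apply: var_expectation_clamp_row; exact: log_likelihood_away_indep.
rewrite var_expectationD // => [|z]; last exact: lne_group_prob_le0.
by rewrite var_expectation_cst // var_expectation_edge_sum.
Qed.

(** * Finiteness at a maximizer and the fixed point equation *)

Lemma complete_likelihood_bounds (R : realType) (n Q M : nat)
    (theta : hsbm_param R Q M) (Y : {set {set 'I_n}}) z :
  0 <= complete_likelihood theta Y z <= 1.
Proof.
have pi01 q : 0 <= group_prob theta q <= 1.
  by rewrite group_prob_ge0 -lee_fin -lne_le0 lne_group_prob_le0.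
have bern01 (e : {set 'I_n}) : (2 <= #|e| <= M)%N ->
    0 <= bernoulli_pmf (conn theta (map_tuple z (enum_tuple e))) (e \in Y) <= 1.
  move=> card_e; rewrite bernoulli_pmf_ge0 ?conn_bounds //=.
  by rewrite -lee_fin -lne_le0 lne_bernoulli_pmf edge_log_le0.
have pi01_prod : 0 <= \prod_j group_prob theta (z j) <= 1.
  by rewrite prodr_ile1 // prodr_ge0 // => j _; case/andP: (pi01 (z j)).
have bern01_prod : 0 <= \prod_(e : {set 'I_n} | (2 <= #|e| <= M)%N)
    bernoulli_pmf (conn theta (map_tuple z (enum_tuple e))) (e \in Y) <= 1.
  by rewrite prodr_ile1 // prodr_ge0 // => e /bern01/andP[].
case/andP: pi01_prod bern01_prod => ? ? /andP[? ?].
by rewrite mulr_ge0 ?mulr_ile1.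
Qed.

Lemma elboE (R : realType) (n Q M : nat) (theta : hsbm_param R Q M)
    (Y : {set {set 'I_n}}) (tau : 'M[R]_(n, Q)) (tau_var : variational tau) :
  elbo theta Y tau =
  (var_expectation tau (fun z => lne (complete_likelihood theta Y z)%:E) -
   (\sum_i \sum_q tau i q * ln (tau i q))%:E)%E.
Proof. by rewrite /elbo var_expectation_entropy. Qed.

(** The point mass at a labelling of positive complete likelihood has a finite lower bound, which
    the maximizer can only improve; the entropy, being real, cannot offset an expectation equal to
    [-oo]. *)
Lemma argmax_elbo_fin (R : realType) (n Q M : nat) (theta : hsbm_param R Q M)
    (Y : {set {set 'I_n}}) (tau : 'M[R]_(n, Q)) :
  0 < likelihood theta Y -> is_argmax_elbo theta Y tau ->
  (-oo < var_expectation tau (fun z => lne (complete_likelihood theta Y z)%:E))%E.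
Proof.
move=> lik_gt0 [tau_var tau_max].
have [z0 z0_gt0] : exists z0, 0 < complete_likelihood theta Y z0.
  case: (pickP (fun z : {ffun _} => 0 < complete_likelihood theta Y z)) => [z|all_le0].
    by exists z.
  move: lik_gt0; rewrite ltNge; case/negP; apply: sumr_le0 => z _.
  by rewrite leNgt all_le0.
pose delta : 'M[R]_(n, Q) := \matrix_(j, q) (q == z0 j)%:R.
have delta_var : variational delta.
  split=> [j q|j]; first by rewrite mxE; case: eqP; rewrite lexx ler01.
  rewrite (bigD1 (z0 j)) //= mxE eqxx big1 ?addr0 // => q /negPf neq_q.
  by rewrite mxE neq_q.
have delta_pmf z : z != z0 -> var_pmf delta z = 0.
  move=> /eqP neq_z; have [j neq_j] : exists j, z j != z0 j.
    apply/existsP; apply: contra_notT neq_z => /existsPn eq_z.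
    by apply/ffunP => j; apply/eqP; rewrite -[_ == _]negbK.
  by rewrite /var_pmf (bigD1 j) //= mxE (negPf neq_j) mul0r.
have delta_fin : (-oo < elbo theta Y delta)%E.
  rewrite elboE // /var_expectation (bigD1 z0) //= big1 => [|z /delta_pmf ->]; last first.
    by rewrite mul0e.
  by rewrite adde0 -/(lne _%:E) lne_EFin // -EFinM -EFinB ltNyr.
have := lt_le_trans delta_fin (tau_max _ delta_var).
by rewrite elboE // !ltNye; apply: contra_neq => ->; rewrite addNye.
Qed.

Lemma entropy_set_row (R : realType) (n Q : nat) (tau : 'M[R]_(n, Q))
    (i : 'I_n) (p : 'I_Q -> R) :
  \sum_j \sum_q set_row tau i p j q * ln (set_row tau i p j q) =
  \sum_q p q * ln (p q) + \sum_(j | j != i) \sum_q tau j q * ln (tau j q).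
Proof.
rewrite (bigD1 i) //=; congr (_ + _); first by apply: eq_bigr => q _; rewrite mxE eqxx.
by apply: eq_bigr => j /negPf neq_ji; apply: eq_bigr => q _; rewrite mxE neq_ji.
Qed.

Theorem proposition4 (R : realType) (n Q M : nat) (hM : (2 <= M)%N)
    (theta : hsbm_param R Q M) (Y : {set {set 'I_n}})
    (hY : simple_hypergraph M Y) (hYtheta : 0 < likelihood theta Y)
    (tau : 'M[R]_(n, Q)) (htau : is_argmax_elbo theta Y tau) :
  exists c : 'I_n -> R,
    (forall (i : 'I_n) (q : 'I_Q),
       lne (tau i q)%:E =
         (lne (group_prob theta q)%:E + fixed_point_term theta Y tau i q
          + (c i)%:E)%E) /\
    (forall i : 'I_n, \sum_(q < Q) tau i q = 1).
Proof.
have elbo_fin := argmax_elbo_fin hYtheta htau.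
have [tau_var tau_max] := htau; have [tau01 tau_sum1] := tau_var.
suff /choice[c cP] : forall i, exists c : R, forall q, lne (tau i q)%:E =
    (lne (group_prob theta q)%:E + fixed_point_term theta Y tau i q + c%:E)%E.
  by exists c.
move=> i; pose L z := lne (complete_likelihood theta Y z)%:E.
have L_le0 z : (L z <= 0)%E.
  by rewrite lne_le0 lee_fin; case/andP: (complete_likelihood_bounds theta Y z).
(* Writing [tau] as a modification of itself lets the formulas for modified rows apply to it as well
   as to its competitors. *)
have tauE : tau = set_row tau i (tau i).
  by apply/matrixP => j q; rewrite mxE; case: eqP => // ->.
have tau_ge0 q : 0 <= tau i q by case/andP: (tau01 i q).
pose A q := var_expectation (clamp_row tau i q) L.
have A_le0 q : (A q <= 0)%E.
  by apply: var_expectation_le0 => //; exact: variational_clamp_row.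
have meanA p : (forall q, 0 <= p q) ->
    var_expectation (set_row tau i p) L = (\sum_q (p q)%:E * A q)%E.
  by move=> p_ge0; exact: var_expectation_set_row.
have [|p p_ge0 p_sum1|c cP] := gibbs_argmax A_le0 tau_ge0 (tau_sum1 i).
- by rewrite -meanA // -tauE.
(* Competitors differ from [tau] in row [i] only; the entropy of the other rows is a common real
   constant and cancels. *)
- rewrite -!meanA // -tauE.
  have := tau_max _ (variational_set_row i p_ge0 p_sum1 tau_var).
  rewrite !elboE //; last exact: variational_set_row.
  rewrite entropy_set_row [in X in (_ <= X)%E -> _]tauE entropy_set_row -tauE.
  by rewrite !EFinD !fin_num_oppeD // !addeA leeD2rE.
(* A label of positive mass serves as reference: [lne] of its mass is finite, which prevents [K]
   from being [-oo]. *)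
have [q1 q1_gt0] : exists q1, 0 < tau i q1.
  case: (pickP (fun q => 0 < tau i q)) => [q|all_le0]; first by exists q.
  move/eqP: (tau_sum1 i); rewrite big1 ?[_ == 1]eq_sym ?oner_eq0 // => q _.
  by apply/eqP; rewrite eq_le tau_ge0 leNgt all_le0.
pose K := var_expectation (clamp_row tau i q1) (log_likelihood_away theta Y i).
have AE q : A q =
    (lne (group_prob theta q)%:E + fixed_point_term theta Y tau i q + K)%E.
  exact: var_expectation_log_likelihood.
have K_fin : K \is a fin_num.
  move: (cP q1); rewrite lne_EFin // AE.
  have : (K <= 0)%E.
    apply: var_expectation_le0; first exact: variational_clamp_row.
    exact: log_likelihood_away_le0.
  by case: (K) => // _; rewrite addeNy addNye.
(* The constant collects the mean log-likelihood away from [i] and the Gibbs normalisation. *)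
by exists (fine K + c) => q; rewrite cP AE EFinD fineK // addeA.
Qed.
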